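(* Let $(A,\mu)$ be a left alternative algebra (resp. right alternative algebra) and let $\alpha,\beta: A\to A$ be two algebra morphisms such that $\alpha\beta=\beta\alpha$. Put $\mu_{\alpha,\beta}=\mu\circ(\alpha\otimes\beta)$, i.e. $\mu_{\alpha,\beta}(x,y)=\mu(\alpha(x),\beta(y))$. Then $A_{\alpha,\beta}=(A,\mu_{\alpha,\beta},\alpha,\beta)$ is a left BiHom-alternative algebra (resp. right BiHom-alternative algebra). Moreover, suppose that $(A',\mu')$ is another left alternative algebra (resp. right alternative algebra) and $\alpha',\beta':A'\to A'$ are two commuting algebra morphisms. If $f:A\to A'$ is an algebra morphism that satisfies $f\alpha=\alpha' f$ and $f\beta=\beta' f$, then $f:A_{\alpha,\beta}\to A'_{\alpha',\beta'}$ is a morphism of left BiHom-alternative algebras (resp. right BiHom-alternative algebras), where $A'_{\alpha',\beta'}=(A',\mu'\circ(\alpha'\otimes\beta'),\alpha',\beta')$.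
   Context: All vector spaces are over an algebraically closed field $\mathbb{K}$ of characteristic $0$; an algebra $(A,\mu)$ is a vector space with a bilinear multiplication $\mu$ (not assumed associative or unital), and an algebra morphism is a linear map compatible with the multiplications. With $as(x,y,z)=\mu(\mu(x,y),z)-\mu(x,\mu(y,z))$, an algebra is left alternative if $as(x,y,z)+as(y,x,z)=0$ for all $x,y,z$, and right alternative if $as(x,y,z)+as(x,z,y)=0$ for all $x,y,z$. For a quadruple $(A,\mu,\alpha,\beta)$ with $\mu:A\otimes A\to A$, $\alpha,\beta:A\to A$ linear, the BiHom-associator is $as_{\alpha,\beta}(x,y,z)=\mu(\mu(x,y),\beta(z))-\mu(\alpha(x),\mu(y,z))$. A left (resp. right) BiHom-alternative algebra is such a quadruple with $\alpha\beta=\beta\alpha$, $\alpha\mu=\mu\alpha^{\otimes 2}$, $\beta\mu=\mu\beta^{\otimes 2}$ and, for all $x,y,z\in A$, $as_{\alpha,\beta}(\beta(x),\alpha(y),z)+as_{\alpha,\beta}(\beta(y),\alpha(x),z)=0$ (resp. $as_{\alpha,\beta}(x,\beta(y),\alpha(z))+as_{\alpha,\beta}(x,\beta(z),\alpha(y))=0$). A morphism $f:(A,\mu,\alpha,\beta)\to(A',\mu',\alpha',\beta')$ of (left/right) BiHom-alternative algebras is a linear map with $f\mu=\mu'(f\otimes f)$, $f\alpha=\alpha' f$, $f\beta=\beta' f$. *)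

(* Defs.v *)
From mathcomp Require Import all_boot all_algebra.

Set Implicit Arguments.
Unset Strict Implicit.
Unset Printing Implicit Defensive.

Import GRing.Theory.
Local Open Scope ring_scope.

(* Multiplications and structure maps are plain functions; (bi)linearity is part
   of each predicate, so that it also has to be established for twisted
   multiplications. *)

Definition algebra (K : fieldType) (A : lmodType K) (mu : A -> A -> A) : Prop :=
  bilinear_for *:%R *:%R mu.

Definition algebra_morphism (K : fieldType) (A A' : lmodType K)
    (mu : A -> A -> A) (mu' : A' -> A' -> A') (f : A -> A') : Prop :=
  linear f /\ {morph f : x y / mu x y >-> mu' x y}.

Definition associator (K : fieldType) (A : lmodType K) (mu : A -> A -> A)
    (x y z : A) : A :=
  mu (mu x y) z - mu x (mu y z).

Definition left_alternative_algebra (K : fieldType) (A : lmodType K)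
    (mu : A -> A -> A) : Prop :=
  algebra mu /\
  forall x y z, associator mu x y z + associator mu y x z = 0.

Definition right_alternative_algebra (K : fieldType) (A : lmodType K)
    (mu : A -> A -> A) : Prop :=
  algebra mu /\
  forall x y z, associator mu x y z + associator mu x z y = 0.

Definition bihom_associator (K : fieldType) (A : lmodType K)
    (mu : A -> A -> A) (alpha beta : A -> A) (x y z : A) : A :=
  mu (mu x y) (beta z) - mu (alpha x) (mu y z).

Definition left_bihom_alternative (K : fieldType) (A : lmodType K)
    (mu : A -> A -> A) (alpha beta : A -> A) : Prop :=
  [/\ algebra mu, linear alpha & linear beta] /\
  [/\ forall x, alpha (beta x) = beta (alpha x),
      {morph alpha : x y / mu x y},
      {morph beta : x y / mu x y} &
      forall x y z,
        bihom_associator mu alpha beta (beta x) (alpha y) z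
        + bihom_associator mu alpha beta (beta y) (alpha x) z = 0].

Definition right_bihom_alternative (K : fieldType) (A : lmodType K)
    (mu : A -> A -> A) (alpha beta : A -> A) : Prop :=
  [/\ algebra mu, linear alpha & linear beta] /\
  [/\ forall x, alpha (beta x) = beta (alpha x),
      {morph alpha : x y / mu x y},
      {morph beta : x y / mu x y} &
      forall x y z,
        bihom_associator mu alpha beta x (beta y) (alpha z)
        + bihom_associator mu alpha beta x (beta z) (alpha y) = 0].

Definition bihom_morphism (K : fieldType) (A A' : lmodType K)
    (mu : A -> A -> A) (alpha beta : A -> A)
    (mu' : A' -> A' -> A') (alpha' beta' : A' -> A') (f : A -> A') : Prop :=
  [/\ linear f,
      {morph f : x y / mu x y >-> mu' x y},
      forall x, f (alpha x) = alpha' (f x) &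
      forall x, f (beta x) = beta' (f x)].

Definition left_bihom_alternative_morphism (K : fieldType) (A A' : lmodType K)
    (mu : A -> A -> A) (alpha beta : A -> A)
    (mu' : A' -> A' -> A') (alpha' beta' : A' -> A') (f : A -> A') : Prop :=
  [/\ left_bihom_alternative mu alpha beta,
      left_bihom_alternative mu' alpha' beta' &
      bihom_morphism mu alpha beta mu' alpha' beta' f].

Definition right_bihom_alternative_morphism (K : fieldType) (A A' : lmodType K)
    (mu : A -> A -> A) (alpha beta : A -> A)
    (mu' : A' -> A' -> A') (alpha' beta' : A' -> A') (f : A -> A') : Prop :=
  [/\ right_bihom_alternative mu alpha beta,
      right_bihom_alternative mu' alpha' beta' &
      bihom_morphism mu alpha beta mu' alpha' beta' f].

Definition twisted_mul (K : fieldType) (A : lmodType K) (mu : A -> A -> A)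
    (alpha beta : A -> A) (x y : A) : A :=
  mu (alpha x) (beta y).

(* Main.v *)
(* For the twisted multiplication, multiplicativity of alpha and beta and
   alpha beta = beta alpha turn the BiHom-associator of (x, y, z) into the
   associator of (alpha^2 x, alpha beta y, beta^2 z).  The arguments
   (beta x, alpha y, z), resp. (x, beta y, alpha z), then put the same map
   alpha^2 beta, resp. alpha beta^2, on the two variables being exchanged. *)
Require Import Defs.
From mathcomp Require Import all_boot all_algebra.

Set Implicit Arguments.
Unset Strict Implicit.
Unset Printing Implicit Defensive.

Import GRing.Theory.
Local Open Scope ring_scope.

Section Twist.

Variables (K : fieldType) (A : lmodType K) (mu : A -> A -> A).
Variables (alpha beta : A -> A).
Hypotheses (alphaP : algebra_morphism mu mu alpha).
Hypotheses (betaP : algebra_morphism mu mu beta).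
Hypothesis (alpha_beta : forall x, alpha (beta x) = beta (alpha x)).

Lemma twisted_algebra : algebra mu -> algebra (twisted_mul mu alpha beta).
Proof.
move: alphaP betaP => [alphaL _] [betaL _] [mul mur].
(* Each goal varies one slot: linearity of [alpha] serves the left slot and that of [beta] the
   right, so one chain of optional rewrites covers both. *)
by split=> u a x y; rewrite /twisted_mul ?alphaL ?betaL ?mul ?mur.
Qed.

(** After expanding, the two sides differ only in the right slot, [alpha (beta y)] against
    [beta (alpha y)]. For [beta] the mismatch sits in the left slot instead. *)
Lemma twisted_morphl : {morph alpha : x y / twisted_mul mu alpha beta x y}.
Proof. by move=> x y; rewrite /twisted_mul (proj2 alphaP) alpha_beta. Qed.

Lemma twisted_morphr : {morph beta : x y / twisted_mul mu alpha beta x y}.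
Proof. by move=> x y; rewrite /twisted_mul (proj2 betaP) alpha_beta. Qed.

Lemma twisted_bihom_associator x y z :
  bihom_associator (twisted_mul mu alpha beta) alpha beta x y z
  = associator mu (alpha (alpha x)) (alpha (beta y)) (beta (beta z)).
Proof.
rewrite /bihom_associator /twisted_mul /associator.
(* [alpha] splits the inner product of the first term and [beta] that of the second; the middle
   entries then agree by commutation. *)
by rewrite (proj2 alphaP) (proj2 betaP) alpha_beta.
Qed.

Lemma twisted_left_bihom_alternative :
  left_alternative_algebra mu ->
  left_bihom_alternative (twisted_mul mu alpha beta) alpha beta.
Proof.
move=> [muA alt]; split; split.
- exact: twisted_algebra.
- exact: (proj1 alphaP).
- exact: (proj1 betaP).
- exact: alpha_beta.
- exact: twisted_morphl.
- exact: twisted_morphr.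
(* The orders alpha alpha beta and alpha beta alpha both occur. Moving every [alpha] outward makes
   the two associators literal swaps of each other, with [beta (beta z)] fixed in third place. *)
by move=> x y z; rewrite !twisted_bihom_associator -!alpha_beta alt.
Qed.

Lemma twisted_right_bihom_alternative :
  right_alternative_algebra mu ->
  right_bihom_alternative (twisted_mul mu alpha beta) alpha beta.
Proof.
move=> [muA alt]; split; split.
- exact: twisted_algebra.
- exact: (proj1 alphaP).
- exact: (proj1 betaP).
- exact: alpha_beta.
- exact: twisted_morphl.
- exact: twisted_morphr.
(* Now every [alpha] moves inward, to the common form beta beta alpha on [y] and [z], with
   [alpha (alpha x)] fixed in first place. *)
by move=> x y z; rewrite !twisted_bihom_associator !alpha_beta alt.
Qed.

End Twist.

(** The intertwining relations carry [f] through the twist slot by slot. The left and right cases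
    share this lemma. *)
Lemma twisted_bihom_morphism (K : fieldType) (A A' : lmodType K)
    (mu : A -> A -> A) (alpha beta : A -> A)
    (mu' : A' -> A' -> A') (alpha' beta' : A' -> A') (f : A -> A') :
  algebra_morphism mu mu' f ->
  (forall x, f (alpha x) = alpha' (f x)) ->
  (forall x, f (beta x) = beta' (f x)) ->
  bihom_morphism (twisted_mul mu alpha beta) alpha beta
    (twisted_mul mu' alpha' beta') alpha' beta' f.
Proof.
move=> [fL fM] fa fb; split=> // x y.
by rewrite /twisted_mul fM fa fb.
Qed.

Theorem theorem1p1 (K : closedFieldType) (charK : [pchar K] =i pred0) :
  (forall (A : lmodType K) (mu : A -> A -> A) (alpha beta : A -> A),
     left_alternative_algebra mu ->
     algebra_morphism mu mu alpha ->
     algebra_morphism mu mu beta ->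
     (forall x, alpha (beta x) = beta (alpha x)) ->
     left_bihom_alternative (twisted_mul mu alpha beta) alpha beta /\
     (forall (A' : lmodType K) (mu' : A' -> A' -> A') (alpha' beta' : A' -> A')
             (f : A -> A'),
        left_alternative_algebra mu' ->
        algebra_morphism mu' mu' alpha' ->
        algebra_morphism mu' mu' beta' ->
        (forall x, alpha' (beta' x) = beta' (alpha' x)) ->
        algebra_morphism mu mu' f ->
        (forall x, f (alpha x) = alpha' (f x)) ->
        (forall x, f (beta x) = beta' (f x)) ->
        left_bihom_alternative_morphism
          (twisted_mul mu alpha beta) alpha beta
          (twisted_mul mu' alpha' beta') alpha' beta' f)) /\
  (forall (A : lmodType K) (mu : A -> A -> A) (alpha beta : A -> A),
     right_alternative_algebra mu ->
     algebra_morphism mu mu alpha ->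
     algebra_morphism mu mu beta ->
     (forall x, alpha (beta x) = beta (alpha x)) ->
     right_bihom_alternative (twisted_mul mu alpha beta) alpha beta /\
     (forall (A' : lmodType K) (mu' : A' -> A' -> A') (alpha' beta' : A' -> A')
             (f : A -> A'),
        right_alternative_algebra mu' ->
        algebra_morphism mu' mu' alpha' ->
        algebra_morphism mu' mu' beta' ->
        (forall x, alpha' (beta' x) = beta' (alpha' x)) ->
        algebra_morphism mu mu' f ->
        (forall x, f (alpha x) = alpha' (f x)) ->
        (forall x, f (beta x) = beta' (f x)) ->
        right_bihom_alternative_morphism
          (twisted_mul mu alpha beta) alpha beta
          (twisted_mul mu' alpha' beta') alpha' beta' f)).
Proof.
split=> A mu alpha beta altA alphaP betaP alpha_beta.
(* [altT] serves twice: as the first claim and as the source structure of the morphism. The target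
   structure is the same lemma over [A']. *)
- have altT := twisted_left_bihom_alternative alphaP betaP alpha_beta altA.
  split=> // A' mu' alpha' beta' f altA' alphaP' betaP' alpha_beta' fP fa fb.
  split=> //; first exact: twisted_left_bihom_alternative.
  exact: twisted_bihom_morphism.
- have altT := twisted_right_bihom_alternative alphaP betaP alpha_beta altA.
  split=> // A' mu' alpha' beta' f altA' alphaP' betaP' alpha_beta' fP fa fb.
  split=> //; first exact: twisted_right_bihom_alternative.
  exact: twisted_bihom_morphism.
Qed.
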